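(* Let $k$ be an uncountable field (so in particular $k$ is not algebraic over a finite subfield), and let $R$ be a $k$-algebra that is noncommutative modulo its Jacobson radical (that is, the quotient of $R$ by its Jacobson radical is a noncommutative ring). Then $R$ contains a free subsemigroup.
   Context: All rings and algebras are associative and unital. ''Free subsemigroup'' always means a multiplicative, noncyclic free subsemigroup: $R$ contains a free subsemigroup if there exist $x,y\in R$ such that the subsemigroup of $(R,\cdot)$ generated by $x$ and $y$ is free on $x,y$ (distinct nonempty words in $x,y$ give distinct elements of $R$). *)

(* Defs.v *)
From HB Require Import structures.
From mathcomp Require Import all_boot all_algebra all_classical.

Set Implicit Arguments.
Unset Strict Implicit.
Unset Printing Implicit Defensive.

Import GRing.Theory.
Local Open Scope classical_set_scope.
Local Open Scope ring_scope.

Section Jacobson.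
Variable R : pzRingType.

Definition left_ideal (I : set R) : Prop :=
  [/\ I 0, forall x y, I x -> I y -> I (x + y) & forall a x, I x -> I (a * x)].

Definition maximal_left_ideal (M : set R) : Prop :=
  [/\ left_ideal M, M <> setT &
      forall I : set R, left_ideal I -> M `<=` I -> I = M \/ I = setT].

Definition jacobson : set R := \bigcap_(M in maximal_left_ideal) M.

Lemma left_idealN (I : set R) x : left_ideal I -> I x -> I (- x).
Proof. by move=> [_ _ IM] Ix; rewrite -mulN1r; apply: IM. Qed.

Lemma left_idealNT (I : set R) : left_ideal I -> I <> setT -> ~ I 1.
Proof.
move=> [_ _ IM] IT I1; apply: IT; apply/seteqP; split=> // x _.
by rewrite -[x]mulr1; apply: IM.
Qed.

Lemma left_ideal_jacobson : left_ideal jacobson.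
Proof.
split.
- by move=> M [[]].
- by move=> x y Jx Jy M mM; case: (mM) => -[_ MD _] _ _; apply: MD; [apply: Jx | apply: Jy].
- by move=> a x Jx M mM; case: (mM) => -[_ _ MM] _ _; apply: MM; apply: Jx.
Qed.

(* For a maximal left ideal M and r not in M, [set x | M (x * r)] is again a
   maximal left ideal, being the annihilator of the class of r in the simple
   module R / M. *)
Lemma maximal_left_ideal_colon (M : set R) r :
  maximal_left_ideal M -> ~ M r -> maximal_left_ideal [set x | M (x * r)].
Proof.
move=> [lM MT Mmax] Mr; case: (lM) => M0 MD MM; split.
- split=> /=; first by rewrite mul0r.
  + by move=> x y Mx My; rewrite mulrDl; apply: MD.
  + by move=> a x Mx; rewrite -mulrA; apply: MM.
- by move=> E; apply: Mr; have : [set: R] 1 by []; rewrite -E /= mul1r.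
move=> I [I0 ID IM] sMI.
have lK : left_ideal [set y | exists2 x, I x & M (y - x * r)].
  split=> /=; first by exists 0 => //; rewrite mul0r subr0.
  - move=> y z [x Ix Mx] [x' Ix' Mx']; exists (x + x'); first exact: ID.
    by rewrite mulrDl opprD addrACA; apply: MD.
  - move=> a y [x Ix Mx]; exists (a * x); first exact: IM.
    by rewrite -mulrA -mulrBr; apply: MM.
have sMK : M `<=` [set y | exists2 x, I x & M (y - x * r)].
  by move=> y My; exists 0 => //; rewrite mul0r subr0.
have [E|E] := Mmax _ lK sMK.
- left; apply/seteqP; split=> //= x Ix; rewrite -E /=.
  by exists x => //; rewrite subrr.
- right; apply/seteqP; split=> // z _.
  have : [set: R] (z * r) by []; rewrite -E => -[x Ix Mzx].
  rewrite -[z](subrK x); apply: ID => //; apply: sMI => /=.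
  by rewrite mulrBl.
Qed.

Lemma jacobsonMr x r : jacobson x -> jacobson (x * r).
Proof.
move=> Jx M mM; have [Mr|Mr] := pselect (M r).
  by case: mM => -[_ _ MM] _ _; apply: MM.
exact: (Jx _ (maximal_left_ideal_colon mM Mr)).
Qed.

Definition jacobson_pred : {pred R} := mem jacobson.

Lemma jacobson_predP x : reflect (jacobson x) (x \in jacobson_pred).
Proof.
have -> : (x \in jacobson_pred) = (x \in jacobson) by [].
by apply: (iffP idP); rewrite in_setE.
Qed.

Lemma jacobson_zmod_closed : zmod_closed jacobson_pred.
Proof.
have lJ := left_ideal_jacobson; have [J0 JD _] := lJ.
split=> [|x y /jacobson_predP Jx /jacobson_predP Jy]; apply/jacobson_predP => //.
exact: JD Jx (left_idealN lJ Jy).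
Qed.

HB.instance Definition _ :=
  GRing.isZmodClosed.Build R jacobson_pred jacobson_zmod_closed.

(* The library quotients rings by ideals only in the commutative case. The
   additive quotient below comes from it; the multiplication induced from R is
   added here. No nontriviality is claimed, so the result is a pzRingType. *)
Definition jacobson_quot := Quotient.quot jacobson_pred.

HB.instance Definition _ := GRing.Zmodule.on jacobson_quot.

Definition jquot_pi (x : R) : jacobson_quot := \pi_(jacobson_quot)%qT x.
Definition jquot_one : jacobson_quot := jquot_pi 1.
Definition jquot_mul (a b : jacobson_quot) : jacobson_quot :=
  jquot_pi (repr a * repr b).

Lemma jquot_piP x y : reflect (jquot_pi x = jquot_pi y) (x - y \in jacobson_pred).
Proof. by rewrite Quotient.idealrBE; apply: eqP. Qed.

Lemma jquot_piK (a : jacobson_quot) : jquot_pi (repr a) = a.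
Proof. exact: reprK. Qed.

Lemma jquot_piD x y : jquot_pi (x + y) = jquot_pi x + jquot_pi y.
Proof. exact: raddfD. Qed.

Lemma jquot_piM x y : jquot_pi (x * y) = jquot_mul (jquot_pi x) (jquot_pi y).
Proof.
rewrite /jquot_mul; set x' := repr _; set y' := repr _.
have /jquot_piP/jacobson_predP Jx : jquot_pi x = jquot_pi x' by rewrite jquot_piK.
have /jquot_piP Jy : jquot_pi y = jquot_pi y' by rewrite jquot_piK.
apply/jquot_piP; rewrite -[x * y](subrK (x' * y)) -addrA -mulrBl -mulrBr rpredD //.
  by apply/jacobson_predP; apply: jacobsonMr.
have [_ _ JM] := left_ideal_jacobson.
by apply/jacobson_predP; apply: JM; apply/jacobson_predP.
Qed.

Lemma jquot_mulA : associative jquot_mul.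
Proof.
move=> a b c; rewrite -(jquot_piK a) -(jquot_piK b) -(jquot_piK c).
by rewrite -!jquot_piM mulrA.
Qed.

Lemma jquot_mul1q : left_id jquot_one jquot_mul.
Proof. by move=> a; rewrite -(jquot_piK a) -jquot_piM mul1r. Qed.

Lemma jquot_mulq1 : right_id jquot_one jquot_mul.
Proof. by move=> a; rewrite -(jquot_piK a) -jquot_piM mulr1. Qed.

Lemma jquot_mulDl : left_distributive jquot_mul +%R.
Proof.
move=> a b c; rewrite -(jquot_piK a) -(jquot_piK b) -(jquot_piK c).
by rewrite -jquot_piD -!jquot_piM -jquot_piD mulrDl.
Qed.

Lemma jquot_mulDr : right_distributive jquot_mul +%R.
Proof.
move=> a b c; rewrite -(jquot_piK a) -(jquot_piK b) -(jquot_piK c).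
by rewrite -jquot_piD -!jquot_piM -jquot_piD mulrDr.
Qed.

HB.instance Definition _ := GRing.Zmodule_isPzRing.Build jacobson_quot
  jquot_mulA jquot_mul1q jquot_mulq1 jquot_mulDl jquot_mulDr.

Lemma jquot_pi_is_monoid_morphism : monoid_morphism jquot_pi.
Proof. by split=> // x y; rewrite jquot_piM. Qed.

Lemma jquot_pi_is_zmod_morphism : zmod_morphism jquot_pi.
Proof. exact: raddfB. Qed.

HB.instance Definition _ := GRing.isZmodMorphism.Build R jacobson_quot jquot_pi
  jquot_pi_is_zmod_morphism.
HB.instance Definition _ := GRing.isMonoidMorphism.Build R jacobson_quot jquot_pi
  jquot_pi_is_monoid_morphism.

End Jacobson.

Definition noncommutative (R : pzRingType) : Prop :=
  exists a b : R, a * b <> b * a.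

(* A word in the letters x, y is a sequence of booleans (true for x). *)
Definition eval_word (R : pzRingType) (x y : R) (w : seq bool) : R :=
  \prod_(b <- w) (if b then x else y).

Definition has_free_subsemigroup (R : pzRingType) : Prop :=
  exists x y : R, forall w1 w2 : seq bool,
    w1 <> [::] -> w2 <> [::] -> eval_word x y w1 = eval_word x y w2 -> w1 = w2.

(* Main.v *)
Require Import Defs.
From mathcomp Require Import all_boot all_algebra all_classical.

Set Implicit Arguments.
Unset Strict Implicit.
Unset Printing Implicit Defensive.

Import GRing.Theory.
Local Open Scope ring_scope.

(** Write ad_b z = z b - b z, and suppose that a and b are elements of R with
    ad_b^m a <> 0 for every m. Then R contains a free subsemigroup, and such a
    pair exists as soon as R is noncommutative modulo its Jacobson radical.

    For the first claim, k being uncountable allows scalars to be replaced by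
    central indeterminates (has_free_subsemigroup_poly). If p(c), q(c) satisfy
    some nontrivial semigroup relation for every scalar c, then, there being
    only countably many relations, a single one holds for infinitely many c,
    hence, by a Vandermonde type argument, identically in c. So it is enough to
    find a free pair over R[s][t], and with V = s - b the elements
      U = (1 + t a) V   and   V
    will do. Indeed, a word of length n in U, V has constant term V^n in t,
    which determines n because V is monic in s. Its coefficient of t is
      \sum_(i < n | the i-th letter is U) V^i a V^(n-i).
    If two distinct words of the same length had the same coefficient, one
    could cancel their common suffix and one further V on the right, which
    leaves V^m a equal to a polynomial of R[s] with V as a right factor. Such a
    polynomial vanishes at s = b when the powers of s are put on the right of
    the coefficients, whereas V^m a takes the value ad_b^m a. The words have
    coefficients 0 and 1 only, so the characteristic never interferes.

    For the second claim, a commutator lies outside some maximal left ideal M,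
    and it suffices to find a and b with ad_b^m a outside M for every m. If M is
    not two-sided, R / M is a simple module on which one can build an element e
    killing the class of 1 and fixing the nonzero class of some r; then
    ad_(-e) r = e r - r e is again r modulo M. If M is two-sided, R / M is a
    division ring. If x and y do not commute modulo M, either ad_x^n y never
    vanishes modulo M, or its last two nonzero terms give some p with
    p x - x p = 1 modulo M, and then ad_(- p x) fixes x modulo M. *)

(** * The inner derivation by an element *)

(** The sign is the one for which left multiplication by the indeterminate
    minus b evaluates at b to ad b; see horner_ad. *)
Definition ad (R : pzRingType) (b z : R) : R := z * b - b * z.

Lemma adB (R : pzRingType) (b x y : R) : ad b (x - y) = ad b x - ad b y.
Proof. by rewrite /ad mulrBl mulrBr !opprB [LHS]addrACA [RHS]addrACA; congr (_ + _); apply: addrC. Qed.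

Lemma adM (R : pzRingType) (b x y : R) : ad b (x * y) = ad b x * y + x * ad b y.
Proof. by rewrite /ad mulrBl mulrBr !mulrA [RHS]addrC addrA subrK. Qed.

Lemma ad1 (R : pzRingType) (b : R) : ad b 1 = 0.
Proof. by rewrite /ad mulr1 mul1r subrr. Qed.

(** * Specializing central indeterminates *)

Lemma uncountable_pigeonhole (T W : Type) (P : T -> W -> Prop) :
    ~ countable [set: T] -> countable [set: W] ->
    (forall x, exists w, P x w) ->
  exists w, infinite_set [set x | P x w]%classic.
Proof.
move=> ncT cW exP; apply: contrapT => fin; apply: ncT.
have -> : [set: T]%classic = (\bigcup_(w in [set: W]) [set x | P x w])%classic.
  by apply/seteqP; split=> // x _; have [w Pxw] := exP x; exists w.
apply: bigcup_countable => // w _; apply: finite_set_countable.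
by apply: contrapT => infw; apply: fin; exists w.
Qed.

Section CentralPoints.
(* The scalars are given by a central morphism f, so that the results also apply
   over {poly R}, with scalars acting through the constant polynomials. *)
Variables (k : fieldType) (R : nzRingType) (f : {rmorphism k -> R}).
Hypothesis fC : forall c x, GRing.comm (f c) x.

(** The usual bound on the number of roots survives over a noncommutative ring
    because the roots are central and their differences invertible: splitting
    off 'X - f c keeps the other roots. *)
Lemma poly_eq0_central_roots (rs : seq k) (p : {poly R}) :
  uniq rs -> (size p <= size rs)%N -> (forall c, c \in rs -> p.[f c] = 0) ->
  p = 0.
Proof.
elim: rs p => [|c rs IH] p /=.
  by move=> _; rewrite leqn0 size_poly_eq0 => /eqP.
case/andP=> c_rs urs sp pr.
have /factor_theorem[q Eq] : root p (f c).
  by apply/rootP; apply: pr; rewrite mem_head.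
have [q0|qn0] := eqVneq q 0; first by rewrite Eq q0 mul0r.
rewrite Eq (IH q) ?mul0r //.
  rewrite -ltnS (leq_trans _ sp) // Eq.
  by rewrite size_Mmonic ?monicXsubC // size_XsubC addn2.
move=> d d_rs; have: p.[f d] = 0 by apply: pr; rewrite inE d_rs orbT.
rewrite Eq hornerM_comm; last exact: fC.
rewrite hornerXsubC -rmorphB => /(congr1 ( *%R^~ (f (d - c)^-1))).
rewrite mul0r -mulrA -rmorphM divff ?rmorph1 ?mulr1 //.
by rewrite subr_eq0; apply: contraNneq c_rs => <-.
Qed.

Lemma horner_eval_word (p q : {poly R}) c w :
  (eval_word p q w).[f c] = eval_word p.[f c] q.[f c] w.
Proof.
rewrite /eval_word; elim: w => [|x w IH]; first by rewrite !big_nil hornerC.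
rewrite !big_cons hornerM_comm; last exact: fC.
by rewrite IH; case: x.
Qed.

(** If every specialization of a free pair p, q satisfied a relation, then
    countability of the set of relations would yield one valid at infinitely
    many scalars, hence valid for p and q themselves. *)
Lemma has_free_subsemigroup_poly :
  ~ countable [set: k] ->
  has_free_subsemigroup {poly R} -> has_free_subsemigroup R.
Proof.
move=> ncK [p [q free]]; apply: contrapT => nfree.
have rel (c : k) : exists w : seq bool * seq bool,
    [/\ w.1 <> [::], w.2 <> [::], w.1 <> w.2 &
        eval_word p.[f c] q.[f c] w.1 = eval_word p.[f c] q.[f c] w.2].
  apply: contrapT => nw; apply: nfree; exists p.[f c], q.[f c] => w1 w2 n1 n2 E.
  by apply: contrapT => n12; apply: nw; exists (w1, w2).
have [[w1 w2]/= inf] := uncountable_pigeonhole ncK (countableP _) rel.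
have [c0 [n1 n2 n12 _]] : exists c, [/\ w1 <> [::], w2 <> [::], w1 <> w2 &
    eval_word p.[f c] q.[f c] w1 = eval_word p.[f c] q.[f c] w2].
  apply: contrapT => none; apply: inf.
  by rewrite (_ : mkset _ = set0)%classic // -subset0 => c Pc; apply: none; exists c.
apply: n12; apply: free => //; apply/eqP; rewrite -subr_eq0; apply/eqP.
set d := _ - _; have [B sB leB] := infinite_set_fset (size d) inf.
apply: poly_eq0_central_roots leB _; first exact: (finmap.fset_uniq B).
move=> c cB; have [_ _ _ E] := sB c cB.
by rewrite hornerD hornerN !horner_eval_word E subrr.
Qed.

End CentralPoints.

(** * A free pair over two central indeterminates *)

Section FreePair.
Variables (R : nzRingType) (a b : R).

Let V : {poly R} := 'X - b%:P.
Let U : {poly {poly R}} := (a%:P * V)%:P * 'X + V%:P.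
Let ev (w : seq bool) := eval_word U V%:P w.

Lemma ev_rcons w x : ev (rcons w x) = ev w * (if x then U else V%:P).
Proof. by rewrite /ev /eval_word -cats1 big_cat big_seq1; case: x. Qed.

Lemma coef0_letter (x : bool) : (if x then U else V%:P)`_0 = V.
Proof. by case: x; rewrite /U ?coefD ?coefMX !coefC /= ?add0r. Qed.

Lemma coef1_letter (x : bool) :
  (if x then U else V%:P)`_1 = if x then a%:P * V else 0.
Proof. by case: x; rewrite /U ?coefD ?coefMX !coefC /= ?addr0. Qed.

Lemma coef0_ev w : (ev w)`_0 = V ^+ size w.
Proof.
elim/last_ind: w => [|w x IH]; first by rewrite /ev /eval_word big_nil coefC.
by rewrite ev_rcons coef0M IH coef0_letter size_rcons exprSr.
Qed.

Lemma coef1_ev_rcons w x :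
  (ev (rcons w x))`_1 = ((ev w)`_1 + V ^+ size w * (a *+ x)%:P) * V.
Proof.
rewrite ev_rcons coefM !big_ord_recl big_ord0 addr0 /= coef0_letter coef1_letter coef0_ev.
by case: x; rewrite /= ?mulr0 ?addr0 ?add0r // mulrDl mulrA addrC.
Qed.

(** The linear coefficient of any word has V as a right factor. *)
Lemma coef1_ev_horner w : ((ev w)`_1).[b] = 0.
Proof.
case/lastP: w => [|w x]; first by rewrite /ev /eval_word big_nil coefC horner0.
rewrite coef1_ev_rcons; apply/rootP/factor_theorem; eexists; reflexivity.
Qed.

(** Evaluation puts the value on the right of the coefficients, so 'X * p takes
    the value p.[b] * b and V * p takes the value ad b p.[b]. *)
Lemma horner_ad m (p : {poly R}) : (V ^+ m * p).[b] = iter m (ad b) p.[b].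
Proof.
elim: m => [|m IH]; first by rewrite mul1r.
by rewrite exprS -mulrA mulrBl hornerD hornerN hornerCM -commr_polyX hornerMX IH.
Qed.

(** Comparing last letters: equal ones cancel since V is monic, hence right
    regular, while different ones would make V ^+ m * a vanish at b, where m is
    the length of what precedes them. *)
Lemma coef1_ev_inj w1 w2 :
    (forall m, iter m (ad b) a <> 0) ->
  size w1 = size w2 -> (ev w1)`_1 = (ev w2)`_1 -> w1 = w2.
Proof.
move=> nad; elim/last_ind: w1 w2 => [|w1 x IH] w2; case/lastP: w2 => [|w2 y] //=;
  rewrite !size_rcons // => -[s12].
rewrite !coef1_ev_rcons => /(monic_rreg (monicXsubC b)); rewrite s12.
have contra m (p q : {poly R}) : p.[b] = 0 -> q.[b] = 0 -> p + V ^+ m * a%:P <> q.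
  move=> p0 q0 /(congr1 (horner^~ b)).
  by rewrite /= hornerD horner_ad hornerC p0 q0 add0r; apply: nad.
case: x y => [] [] /=; rewrite ?mulr0n ?mulr0 ?addr0.
- by move/addIr/IH->.
- by move/contra; case; rewrite coef1_ev_horner.
- by move/esym/contra; case; rewrite coef1_ev_horner.
- by move/IH->.
Qed.

(** The constant coefficient of a relation equates the lengths of the two words,
    and the linear one then equates the words. *)
Lemma has_free_subsemigroup_poly2 :
  (forall m, iter m (ad b) a <> 0) -> has_free_subsemigroup {poly {poly R}}.
Proof.
move=> nad; exists U, V%:P => w1 w2 _ _ E.
apply: coef1_ev_inj nad _ (congr1 (fun p : {poly _} => p`_1) E).
have /(congr1 (fun p : {poly R} => size p)) := congr1 (fun p : {poly _} => p`_0) E.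
by rewrite /= -/(ev w1) -/(ev w2) !coef0_ev !size_exp_XsubC => -[].
Qed.

End FreePair.

(** Both indeterminates are specialized in turn, first the outer and then the
    inner one. *)
Lemma has_free_subsemigroup_ad (k : fieldType) (R : algType k) (a b : R) :
    ~ countable [set: k] ->
  (forall m, iter m (ad b) a <> 0) -> has_free_subsemigroup R.
Proof.
move=> ncK nad.
have fC c (x : R) : GRing.comm (in_alg R c) x.
  by rewrite /GRing.comm /= mulr_algl mulr_algr.
apply: (has_free_subsemigroup_poly fC ncK).
apply: (@has_free_subsemigroup_poly _ _ (polyC \o in_alg R)) => //.
  move=> c p; apply/polyP=> i; rewrite /= coefCM coefMC; exact: fC.
exact: has_free_subsemigroup_poly2 nad.
Qed.

(** * Inner derivations that are not nil modulo a maximal left ideal *)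

Section MaximalLeftIdeal.
Variables (R : pzRingType) (M : set R).
Hypothesis maxM : maximal_left_ideal M.

Let lM : left_ideal M. Proof. by case: maxM. Qed.
Let M0 : M 0. Proof. by case: lM. Qed.
Let MD x y : M x -> M y -> M (x + y). Proof. by case: lM => _ + _; apply. Qed.
Let MM r x : M x -> M (r * x). Proof. by case: lM => _ _; apply. Qed.
Let MN x : M x -> M (- x). Proof. exact: left_idealN. Qed.
Let MB x y : M x -> M y -> M (x - y). Proof. by move=> Mx /MN; apply: MD. Qed.

Lemma maximal_left_ideal_inv r : ~ M r -> exists s, M (s * r - 1).
Proof.
move=> Mr; pose I : set R := [set y | exists s, M (y - s * r)]%classic.
have lI : left_ideal I.
  split=> [|x y [s Ms] [t Mt]|c x [s Ms]].
  - by exists 0; rewrite mul0r subr0.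
  - by exists (s + t); rewrite mulrDl opprD addrACA; apply: MD.
  - by exists (c * s); rewrite -mulrA -mulrBr; apply: MM.
have sMI : (M `<=` I)%classic by move=> x Mx; exists 0; rewrite mul0r subr0.
have [_ _ /(_ I lI sMI)[IM|IT]] := maxM.
  by case: Mr; rewrite -IM; exists 1; rewrite mul1r subrr.
have [s Ms] : I 1 by rewrite IT.
by exists s; rewrite -opprB; apply: MN.
Qed.

(** Take s with s m r = 1 modulo M. Then e = r s m lies in M and e r = r modulo
    M, so r is fixed modulo M by z |-> e z - z e. *)
Lemma ad_notin_of_not_two_sided m r :
    M m -> ~ M (m * r) ->
  exists a b, forall n, ~ M (iter n (ad b) a).
Proof.
move=> Mm Mmr; have [s Es] := maximal_left_ideal_inv Mmr.
pose e := r * s * m.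
have Me : M e by apply: MM.
have Eer : M (e * r - r).
  by have := MM r Es; rewrite mulrBr mulr1 !mulrA.
exists r, (- e) => n En.
suff Enr : M (iter n (ad (- e)) r - r).
  apply: Mmr; apply: MM; rewrite -[r](subKr (iter n (ad (- e)) r)).
  exact: MB.
elim: n {En} => [|n IH]; first by rewrite subrr.
rewrite iterS; move: (iter n _ _) IH => z IH; rewrite /ad.
have -> : z * - e - (- e * z) - r = e * (z - r) + (e * r - r) - z * e.
  by rewrite mulrN mulNr opprK mulrBr [in RHS]addrA subrK [RHS]addrAC; congr (_ - _); apply: addrC.
by apply: MB; [apply: MD => //; apply: MM | apply: MM].
Qed.

(** If ad x is nilpotent at y modulo M, then some a has c = ad x a nonzero and
    ad x c = 0 modulo M. As the inverse d of c modulo M also commutes with x,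
    p = d a satisfies p x - x p = 1 modulo M: a Weyl algebra relation, whose
    Euler element p x has x as an eigenvector for a nonzero eigenvalue. *)
Lemma ad_notin_of_two_sided x y :
    (forall z r, M z -> M (z * r)) -> ~ M (ad x y) ->
  exists a b, forall n, ~ M (iter n (ad b) a).
Proof.
(* R / M has no zero divisors. *)
move=> MMr Mxy; have prime z c : M (z * c) -> ~ M c -> M z.
  move=> Mzc Mc; apply: contrapT => /maximal_left_ideal_inv[s Ms]; apply: Mc.
  rewrite -[c](subKr (s * z * c)); apply: MB; first by rewrite -mulrA; apply: MM.
  by rewrite -{2}[c]mul1r -mulrBl; apply: MMr.
have [nil|] := pselect (exists n, `[< M (iter n (ad x) y) >]); last first.
  by move=> nn; exists y, x => n Mn; apply: nn; exists n; apply/asboolP.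
case: (ex_minnP nil) => -[|[|n]] /asboolP Mn minn {nil}.
- by case: Mxy; rewrite /ad; apply: MB; [apply: MMr | apply: MM].
- by [].
(* n.+2 is the least exponent for which the iterate of ad x at y is in M. *)
pose a := iter n (ad x) y; pose c := ad x a.
have Mc : ~ M c by move/asboolP/(minn n.+1); rewrite ltnn.
have [d Md] := maximal_left_ideal_inv Mc.
have Mxd : M (ad x d).
  apply: (prime _ c) => //.
  have -> : ad x d * c = ad x (d * c - 1) - d * ad x c.
    by rewrite adB ad1 subr0 adM addrK.
  by apply: MB; [apply: MB; [apply: MMr | apply: MM] | apply: MM].
pose p := d * a; have Mp : M (ad x p - 1).
  have -> : ad x p - 1 = (d * c - 1) + ad x d * a.
    by rewrite adM [RHS]addrC addrA.
  by apply: MD => //; apply: MMr.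
have Mx : ~ M x by move=> Mx; apply: Mxy; apply: MB; [apply: MM | apply: MMr].
exists x, (- (p * x)) => m Mm; apply: Mx.
rewrite -[x](subKr (iter m (ad (- (p * x))) x)).
apply: MB => //; elim: m {Mm} => [|m IH]; first by rewrite subrr.
rewrite iterS; move: (iter m _ _) IH => z IH.
have -> : ad (- (p * x)) z - x = ad (- (p * x)) (z - x) + (ad x p - 1) * x.
  have adx : ad (- (p * x)) x = ad x p * x.
    by rewrite /ad mulrN mulNr opprK mulrBl !mulrA addrC.
  by rewrite adB adx mulrBl mul1r addrA subrK.
by apply: MD; [apply: MB; [apply: MMr | apply: MM] | apply: MMr].
Qed.

Lemma maximal_left_ideal_ad_notin x y :
  ~ M (ad x y) -> exists a b, forall n, ~ M (iter n (ad b) a).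
Proof.
move=> Mxy.
have [two|/existsNP[m /existsNP[r /not_implyP[Mm Mmr]]]] :=
    pselect (forall z r, M z -> M (z * r)).
  exact: ad_notin_of_two_sided Mxy.
exact: ad_notin_of_not_two_sided Mm Mmr.
Qed.

End MaximalLeftIdeal.

Lemma noncommutative_quot_ad (R : pzRingType) :
  noncommutative (jacobson_quot R) ->
  exists a b : R, forall n, iter n (ad b) a <> 0.
Proof.
move=> [x [y nxy]].
have /existsNP[M /not_implyP[maxM Mxy]] : ~ jacobson (ad (repr y) (repr x)).
  move/jacobson_predP/jquot_piP; rewrite !jquot_piM !jquot_piK; exact: nxy.
have [a [b Mn]] := maximal_left_ideal_ad_notin maxM Mxy.
by exists a, b => n E; apply: (Mn n); rewrite E; case: maxM => -[].
Qed.

Theorem mainTheorem3 (k : fieldType) (R : algType k)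
  (k_uncountable : ~ countable [set: k])
  (R_noncomm : noncommutative (jacobson_quot R)) :
  has_free_subsemigroup R.
Proof.
have [a [b nad]] := noncommutative_quot_ad R_noncomm.
exact: has_free_subsemigroup_ad k_uncountable nad.
Qed.
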